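(* There is a universal constant $c>0$ such that for every sufficiently large $n$ and every convex body $K\subset\mathbb{R}^n$ in John's position, there exists a polytope $P\subset\mathbb{R}^n$ with at most $\exp(c\log(n)\,n)$ facets such that $$\frac12 P\subset K\subset P.$$
   Context: A convex body in $\mathbb{R}^n$ is a compact convex set with non-empty interior. The John ellipsoid of a convex body is the unique ellipsoid of maximal volume contained in it. A convex body is in John's position if its John ellipsoid is the Euclidean unit ball $B_2^n$ centered at the origin. A polytope is a compact convex polytope, and its number of facets is the number of its $(n-1)$-dimensional faces. For $t>0$, $tP=\{tx : x\in P\}$. *)

(* Defs.v *)
From mathcomp Require Import all_boot all_order all_algebra.
From mathcomp Require Import all_classical all_reals all_analysis.

Set Implicit Arguments.
Unset Strict Implicit.
Unset Printing Implicit Defensive.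

Import Order.TTheory GRing.Theory Num.Theory.
Import numFieldNormedType.Exports.

Local Open Scope classical_set_scope.
Local Open Scope ring_scope.

Definition dotp (R : realType) (n : nat) (x y : 'rV[R]_n) : R :=
  \sum_(i < n) x 0 i * y 0 i.

(* The norm of the library on 'rV[R]_n is the sup norm. *)
Definition enorm (R : realType) (n : nat) (x : 'rV[R]_n) : R :=
  Num.sqrt (dotp x x).

Definition eball (R : realType) (n : nat) : set 'rV[R]_n :=
  [set x | enorm x <= 1].

Definition convex_body (R : realType) (n : nat) (K : set 'rV[R]_n) : Prop :=
  [/\ compact K,
      convex_set (K : set (convex_lmodType 'rV[R]_n)) &
      interior K !=set0].

Definition box (R : realType) (n : nat) (a b : 'rV[R]_n) : set 'rV[R]_n :=
  [set x | forall i, a 0 i <= x 0 i <= b 0 i].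

Definition box_volume (R : realType) (n : nat) (a b : 'rV[R]_n) : R :=
  \prod_(i < n) (b 0 i - a 0 i).

Definition box_cover (R : realType) (n : nat) (A : set 'rV[R]_n)
    (a b : nat -> 'rV[R]_n) : Prop :=
  (forall k i, a k 0 i <= b k 0 i) /\ A `<=` \bigcup_k box (a k) (b k).

(* The n-dimensional Lebesgue outer measure; it is the Lebesgue measure on
   measurable sets, in particular on ellipsoids. *)
Definition volume (R : realType) (n : nat) (A : set 'rV[R]_n) : \bar R :=
  ereal_inf [set s : \bar R | exists a b : nat -> 'rV[R]_n, box_cover A a b /\
    s = (\sum_(0 <= k <oo) (box_volume (a k) (b k))%:E)%E].

Definition ellipsoid (R : realType) (n : nat) (E : set 'rV[R]_n) : Prop :=
  exists (v : 'rV[R]_n) (M : 'M[R]_n),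
    M \in unitmx /\ E = [set v + x *m M | x in @eball R n].

Definition max_volume_ellipsoid (R : realType) (n : nat)
    (K E : set 'rV[R]_n) : Prop :=
  [/\ ellipsoid E, E `<=` K &
      forall E' : set 'rV[R]_n,
        ellipsoid E' -> E' `<=` K -> (volume E' <= volume E)%E].

Definition john_ellipsoid (R : realType) (n : nat)
    (K E : set 'rV[R]_n) : Prop :=
  unique (max_volume_ellipsoid K) E.

Definition john_position (R : realType) (n : nat) (K : set 'rV[R]_n) : Prop :=
  john_ellipsoid K (@eball R n).

Definition halfspace (R : realType) (n : nat) (u : 'rV[R]_n) (b : R) :
  set 'rV[R]_n := [set x | dotp u x <= b].

(* Possibly empty or lower-dimensional. *)
Definition polytope (R : realType) (n : nat) (P : set 'rV[R]_n) : Prop :=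
  compact P /\
  exists (m : nat) (u : 'I_m -> 'rV[R]_n) (b : 'I_m -> R),
    (forall i, u i != 0) /\ P = [set x | forall i, halfspace (u i) (b i) x].

(* F is nonempty and its affine hull, of which V is the direction, has
   dimension k. *)
Definition has_dim (R : realType) (n : nat) (F : set 'rV[R]_n) (k : nat) :
  Prop :=
  exists (x0 : 'rV[R]_n) (V : {vspace 'rV[R]_n}),
    [/\ F x0, \dim V = k,
        forall x, F x -> x - x0 \in V &
        forall W : {vspace 'rV[R]_n},
          (forall x, F x -> x - x0 \in W) -> (V <= W)%VS].

Definition face (R : realType) (n : nat) (P F : set 'rV[R]_n) : Prop :=
  exists (u : 'rV[R]_n) (b : R),
    P `<=` halfspace u b /\ F = P `&` [set x | dotp u x = b].

Definition facets (R : realType) (n : nat) (P : set 'rV[R]_n) :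
  set (set 'rV[R]_n) := [set F | face P F /\ has_dim F n.-1].

Definition dilate (R : realType) (n : nat) (t : R) (P : set 'rV[R]_n) :
  set 'rV[R]_n := [set t *: x | x in P].

(* Main.v *)
Require Import Defs.
From mathcomp Require Import all_boot all_order all_algebra.
From mathcomp Require Import all_classical all_reals all_analysis.
From mathcomp Require Import ring lra.

Import Order.TTheory GRing.Theory Num.Theory.
Import numFieldNormedType.Exports.

Local Open Scope classical_set_scope.
Local Open Scope ring_scope.

(** The approximating polytope comes from a net of directions. If the Euclidean
    unit ball B lies in K and K lies in a cube of half-side r, let g run over a
    grid of mesh 1/q in the cube of half-side 1, and cut out P by the half-spaces
    on which dotp g is at most its supremum over K. Then K is contained in P. For
    the other inclusion, a point x of P with x/2 outside K is cut off from K by a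
    direction v of sup norm 1. Since K contains B, the support function of K at v
    is at least 1, so passing from v to a nearby grid vector, which costs at most
    about n^2 r / q, changes it by a factor at most 2 once q is of order
    n^2 r. The grid has (2q)^n points, and a facet of P is always the intersection
    of P with the boundary of one of its defining half-spaces, so P has at most
    (2q)^n facets. These steps are grid_polytope and facets_le_constraints. If r
    is polynomial in n, the bound has the form exp(c n log n).

    John's position enters only to bound K, in john_position_bounded: every point
    of K has norm less than 4n + 1. Suppose that K contains r y with y a unit
    vector and r at least 4n + 1. Stretch B by the factor 2 along y, shrink it by
    1 - 1/(2n) orthogonally to y, and translate it by y. The result stays in the
    convex hull of B and r y (stretched_ball_sub), hence in K. Its volume is
    2 (1 - 1/(2n))^(n-1) times that of B, which is at least the volume of B by
    Bernoulli's inequality. It is an ellipsoid in K different from B, and so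
    contradicts the uniqueness of the ellipsoid of maximal volume.

    The comparison of volumes uses that the linear maps involved do not multiply
    the outer measure by more than their determinant. A transvection is treated
    by slicing boxes, and a rank-one perturbation of the identity is a product of
    transvections and of a scaling of one coordinate (scales_volume_rank_one). *)

(** * The dot product and separation of a point from a convex body *)
Section DotProduct.
Context {R : realType} {n : nat}.
Implicit Types (x y z u : 'rV[R]_n) (t : R) (K : set 'rV[R]_n).

Lemma dotpC x y : dotp x y = dotp y x.
Proof. by apply: eq_bigr => i _; rewrite mulrC. Qed.

Lemma dotpDl x y z : dotp (x + y) z = dotp x z + dotp y z.
Proof. by rewrite -big_split; apply: eq_bigr => i _; rewrite mxE mulrDl. Qed.

Lemma dotpZl t x y : dotp (t *: x) y = t * dotp x y.
Proof. by rewrite mulr_sumr; apply: eq_bigr => i _; rewrite mxE mulrA. Qed.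

Lemma dotpDr x y z : dotp x (y + z) = dotp x y + dotp x z.
Proof. by rewrite dotpC dotpDl !(dotpC _ x). Qed.

Lemma dotpZr t x y : dotp x (t *: y) = t * dotp x y.
Proof. by rewrite dotpC dotpZl dotpC. Qed.

Lemma dotpNl x y : dotp (- x) y = - dotp x y.
Proof. by rewrite -scaleN1r dotpZl mulN1r. Qed.

Lemma dotpNr x y : dotp x (- y) = - dotp x y.
Proof. by rewrite dotpC dotpNl dotpC. Qed.

Lemma dotp0l x : dotp 0 x = 0.
Proof. by rewrite -(scale0r 0) dotpZl mul0r. Qed.

Lemma dotp0r x : dotp x 0 = 0.
Proof. by rewrite dotpC dotp0l. Qed.

Definition dotpE := (dotpDl, dotpDr, dotpZl, dotpZr, dotpNl, dotpNr).

Lemma dotp_ge0 x : 0 <= dotp x x.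
Proof. by apply: sumr_ge0 => i _; rewrite -expr2 sqr_ge0. Qed.

Lemma dotp_gt0 x : x != 0 -> 0 < dotp x x.
Proof.
move=> x0; rewrite lt_def dotp_ge0 andbT; apply: contra_neq x0 => xx0.
apply/rowP => i; rewrite mxE; apply/eqP; rewrite -(sqrf_eq0 (x 0 i)).
move/eqP: xx0; rewrite psumr_eq0 => [/allP/(_ i)|j _]; last first.
  by rewrite -expr2 sqr_ge0.
by rewrite mem_index_enum expr2; apply.
Qed.

Lemma dotp_delta x i : dotp x (delta_mx 0 i) = x 0 i.
Proof.
rewrite /dotp (bigD1 i)//= mxE !eqxx mulr1 big1 ?addr0// => j ji.
by rewrite mxE (negbTE ji) andbF mulr0.
Qed.

Lemma Cauchy_Schwarz_dotp x y : dotp x y ^+ 2 <= dotp x x * dotp y y.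
Proof.
have [->|y0] := eqVneq y 0.
  by rewrite !dotp0r mulr0 expr0n.
have yy := dotp_gt0 y y0.
have := dotp_ge0 (dotp y y *: x - dotp x y *: y).
rewrite !dotpE (dotpC y x) => h.
by rewrite -subr_ge0 -(pmulr_rge0 _ yy); lra.
Qed.

Lemma dotp_le_sup x y (a b : R) :
  (forall i, `|x 0 i| <= a) -> (forall i, `|y 0 i| <= b) ->
  dotp x y <= n%:R * (a * b).
Proof.
move=> xa yb; have -> : n%:R * (a * b) = \sum_(i < n) (a * b).
  by rewrite sumr_const card_ord mulr_natl.
apply: ler_sum => i _; apply: le_trans (ler_norm _) _.
by rewrite normrM ler_pM.
Qed.

Lemma continuous_sum (F : 'I_n -> 'rV[R]_n -> R) :
  (forall i, continuous (F i)) -> continuous (fun x => \sum_(i < n) F i x).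
Proof.
move=> Fc; apply: (@continuous_big R 'I_n +%R 0 xpredT _ _ _ F) => [|i _].
  exact: (@add_continuous R).
exact: Fc.
Qed.

Lemma continuous_dotp x : continuous (dotp x : 'rV[R]_n -> R).
Proof.
refine (continuous_sum (fun i y => x 0 i * y 0 i) _) => i y.
apply: (@continuousM _ _ (fun=> x 0 i)); first exact: cst_continuous.
exact: coord_continuous.
Qed.

Lemma continuous_sqr_dist z :
  continuous (fun x : 'rV[R]_n => dotp (z - x) (z - x)).
Proof.
refine (continuous_sum (fun i x => (z - x) 0 i * (z - x) 0 i) _) => i y.
suff h : {for y, continuous (fun x : 'rV[R]_n => (z - x) 0 i)}.
  exact: (continuousM h h).
rewrite (_ : (fun x : 'rV[R]_n => _) = (fun x => z 0 i - x 0 i)); last first.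
  by apply/funext => x; rewrite !mxE.
apply: (@continuousB _ _ _ (fun=> z 0 i)); first exact: cst_continuous.
exact: coord_continuous.
Qed.

Lemma convex_setE K x y t : convex_set (K : set (convex_lmodType 'rV[R]_n)) ->
  K x -> K y -> 0 <= t -> t <= 1 -> K (t *: x + (1 - t) *: y).
Proof.
move=> cK Kx Ky t0 t1.
by have := cK x y (Itv01 t0 t1); rewrite !inE; apply.
Qed.

(** The separating direction is z - p for the point p of K nearest to z:
    otherwise moving p slightly towards a point of K on the wrong side would
    bring it closer to z. *)
Lemma strict_separation K z : compact K ->
  convex_set (K : set (convex_lmodType 'rV[R]_n)) -> K !=set0 -> ~ K z ->
  exists u c, (forall x, K x -> dotp u x <= c) /\ c < dotp u z.
Proof.
move=> cK vK K0 Kz.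
have [p /[!inE] Kp pmin] := @EVT_min_rV R n _ K K0 cK
  (continuous_subspaceT (continuous_sqr_dist z)).
exists (z - p), (dotp (z - p) p); split; last first.
  rewrite -subr_gt0 -dotpNr -dotpDr dotp_gt0// subr_eq0.
  by apply: contra_not_neq Kz => ->.
move=> y Ky; rewrite leNgt; apply/negP => ylt.
set s := dotp (z - p) (y - p).
have s0 : 0 < s by rewrite /s dotpDr dotpNr subr_gt0.
set D := dotp (y - p) (y - p); have D0 : 0 <= D by exact: dotp_ge0.
have sD : 0 < s + D by lra.
(* The squared distance decreases by t (2 s - t D), positive for this t. *)
pose t := s / (s + D).
have t0 : 0 < t by rewrite divr_gt0.
have t1 : t <= 1 by rewrite ler_pdivrMr//; lra.
have Kq := convex_setE K y p t vK Ky Kp (ltW t0) t1.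
have := pmin (t *: y + (1 - t) *: p); rewrite inE => /(_ Kq).
have -> : z - (t *: y + (1 - t) *: p) = (z - p) - t *: (y - p).
  by apply/rowP => i; rewrite !mxE; ring.
rewrite (dotpDl (z - p) (- (t *: (y - p)))).
rewrite !(dotpDr _ (z - p) (- (t *: (y - p)))).
rewrite !dotpNr !dotpNl !dotpZr !dotpZl (dotpC (y - p) (z - p)) -/s -/D => h.
have : t * (2 * s) <= t * (t * D) by lra.
rewrite ler_pM2l// => h2.
have : t * (s + D) = s by rewrite /t mulfVK// gt_eqF.
have : 0 <= t * s by rewrite mulr_ge0 ?ltW.
lra.
Qed.

End DotProduct.

(** * How the outer measure changes under elementary maps *)
Section Volume.
Context {R : realType} {n : nat}.
Implicit Types (x y : 'rV[R]_n) (A : set 'rV[R]_n).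

Lemma box_volume_ge0 x y : (forall i, x 0 i <= y 0 i) -> 0 <= box_volume x y.
Proof. by move=> xy; apply: prodr_ge0 => i _; rewrite subr_ge0. Qed.

Lemma volume_ge0 A : (0 <= volume A)%E.
Proof.
apply: le_ereal_inf_tmp => _ [a [b [[ab _] ->]]].
by apply: nneseries_ge0 => k _ _; rewrite lee_fin box_volume_ge0.
Qed.

(** Choose for the k-th set a cover whose total volume exceeds the infimum by at
    most e / 2^(k+1), and enumerate all boxes of all covers by a bijection of nat
    with nat * nat. *)
Lemma volume_sigma_subadditive (A : set 'rV[R]_n) (F : nat -> set 'rV[R]_n) :
  A `<=` \bigcup_k F k -> (volume A <= \sum_(k <oo) volume (F k))%E.
Proof.
move=> AF.
have [[i ioo]|] := pselect (exists i, volume (F i) = +oo%E).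
  rewrite (eseries_pinfty _ _ ioo) ?leey// => k _.
  by rewrite -ltNye (lt_le_trans _ (volume_ge0 _)).
rewrite -forallNE => Foo.
apply/lee_addgt0Pr => e e0.
apply: (le_trans _ (epsilon_trick _ _ (ltW e0))); last first.
  by move=> k; exact: volume_ge0.
pose P k (c : (nat -> 'rV[R]_n) * (nat -> 'rV[R]_n)) :=
  box_cover (F k) c.1 c.2 /\
  (\sum_(0 <= j <oo) (box_volume (c.1 j) (c.2 j))%:E <=
     volume (F k) + (e / (2 ^ k.+1)%:R)%:E)%E.
have [G PG] : {G & forall k, P k (G k)}.
  apply: (@choice _ _ P) => k.
  have fink : volume (F k) \is a fin_num.
    by rewrite ge0_fin_numE ?volume_ge0// ltey; apply/eqP/Foo.
  have ek : 0 < e / (2 ^ k.+1)%:R by rewrite divr_gt0// ltr0n expn_gt0.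
  have [s [a [b [ab ->]]] lts] := lb_ereal_inf_adherent ek fink.
  by exists (a, b); split => //; exact: ltW.
pose a (p : nat * nat) := (G p.1).1 p.2.
pose b (p : nat * nat) := (G p.1).2 p.2.
have ab p i : a p 0 i <= b p 0 i by have [[h _] _] := PG p.1; exact: h.
pose v p := (box_volume (a p) (b p))%:E.
have v0 p : (0 <= v p)%E by rewrite lee_fin; apply: box_volume_ge0 => i.
apply: (@le_trans _ _ (\esum_(p in [set: nat * nat]) v p)).
  have /card_esym/ppcard_eqP[f] := card_nat2.
  apply: ereal_inf_lbound; exists (a \o f), (b \o f); split.
    split=> [k i|x /AF[k _ Fkx]]; first exact: ab.
    have [[_ /(_ _ Fkx)[j _ xj]] _] := PG k.
    by exists (f^-1%FUN (k, j)) => //=; rewrite invK ?inE.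
  rewrite nneseries_esumT => [|k]; last exact: (v0 (f k)).
  by rewrite (reindex_esum [set: nat] _ f).
rewrite (_ : \esum_(p in _) v p = \sum_(k <oo) \sum_(j <oo) v (k, j))%E;
  last first.
  rewrite nneseries_esumT => [|k]; last by apply: nneseries_ge0.
  under [RHS]eq_esum do rewrite nneseries_esumT//.
  rewrite (esum_esum (J := fun=> setT)) => [|k j _ _]; last exact: v0.
  by congr esum; apply/seteqP; split => -[].
apply: lee_nneseries => [k _ _|k _]; first exact: nneseries_ge0.
exact: (PG k).2.
Qed.

(** A finite cover is completed to a countable one by degenerate boxes, whose
    volume vanishes because the dimension is positive. *)
Lemma volume_le_sum_boxes (A : set 'rV[R]_n) (N : nat)
    (a b : nat -> 'rV[R]_n) :
  (0 < n)%N -> (forall k i, a k 0 i <= b k 0 i) ->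
  A `<=` \bigcup_(k in `I_N) box (a k) (b k) ->
  (volume A <= (\sum_(k < N) box_volume (a k) (b k))%:E)%E.
Proof.
move=> n0 ab Acov.
pose b' k := if (k < N)%N then b k else a k.
have ab' k i : a k 0 i <= b' k 0 i by rewrite /b'; case: ifP.
apply: ereal_inf_lbound; exists a, b'; split.
  split=> // x /Acov[k /= kN xk]; exists k => //.
  by rewrite /b' kN.
rewrite (nneseries_split 0 N) => [|k _]; last by rewrite lee_fin box_volume_ge0.
rewrite [X in (_ + X)%E]eseries0 => [|k Nk _]; last first.
  rewrite /b' ltnNge Nk /= /box_volume; apply/eqP; rewrite eqe.
  rewrite prodf_seq_eq0; apply/hasP; exists (Ordinal n0) => /=.
    exact: mem_index_enum.
  by rewrite subrr.
rewrite adde0 add0n big_mkord -sumEFin; apply: eq_bigr => k _.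
by rewrite /b' ltn_ord.
Qed.

(** An inequality, unlike an equality, can be checked on boxes without knowing
    that the outer measure of a box is its volume. *)
Definition scales_volume (f : 'rV[R]_n -> 'rV[R]_n) (d : R) :=
  forall A, (volume (f @` A) <= d%:E * volume A)%E.

Lemma scales_volume_boxes (f : 'rV[R]_n -> 'rV[R]_n) (d : R) : 0 < d ->
  (forall a b : 'rV[R]_n, (forall i, a 0 i <= b 0 i) ->
    (volume (f @` box a b) <= (d * box_volume a b)%:E)%E) ->
  scales_volume f d.
Proof.
move=> d0 fbox A.
rewrite -lee_pdivrMl//; apply: le_ereal_inf_tmp => _ [a [b [[ab Acov] ->]]].
rewrite lee_pdivrMl// -nneseriesZl => [|k _]; last first.
  by rewrite lee_fin box_volume_ge0.
apply: (le_trans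
  (volume_sigma_subadditive _ (fun k => f @` box (a k) (b k)) _)).
  by move=> _ [x /Acov[k _ xk] <-]; exists k => //; exists x.
by apply: lee_nneseries => [k _ _|k _]; [exact: volume_ge0|exact: fbox].
Qed.

Lemma scales_volume_box_image (f : 'rV[R]_n -> 'rV[R]_n) (d : R)
    (g h : 'rV[R]_n -> 'rV[R]_n -> 'rV[R]_n) :
  (0 < n)%N -> 0 < d ->
  (forall a b : 'rV[R]_n, (forall i, a 0 i <= b 0 i) ->
    [/\ forall i, g a b 0 i <= h a b 0 i,
        forall x, box a b x -> box (g a b) (h a b) (f x) &
        box_volume (g a b) (h a b) = d * box_volume a b]) ->
  scales_volume f d.
Proof.
move=> n0 d0 fbox; apply: scales_volume_boxes => // a b ab.
have [gh fgh <-] := fbox a b ab.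
apply: le_trans
  (volume_le_sum_boxes _ 1 (fun=> g a b) (fun=> h a b) n0 _ _) _ => //.
  by move=> _ [x xab <-]; exists 0%N => //; exact: fgh.
by rewrite big_ord1.
Qed.

Lemma scales_volume_comp f g (d e : R) : 0 <= d ->
  scales_volume f d -> scales_volume g e -> scales_volume (f \o g) (d * e).
Proof.
move=> d0 fd ge A; rewrite -image_comp EFinM -muleA.
by apply: le_trans (fd _) _; rewrite lee_wpmul2l// lee_fin.
Qed.

Lemma scales_volume_id : scales_volume id 1.
Proof. by move=> A; rewrite image_id mul1e. Qed.

Lemma scales_volume_translation (v : 'rV[R]_n) :
  (0 < n)%N -> scales_volume (fun x => x + v) 1.
Proof.
move=> n0; apply: (scales_volume_box_image _ _
  (fun a _ => a + v) (fun _ b => b + v)) => // a b ab.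
split=> [i|x xab i|]; first by rewrite !mxE lerD2r.
  by rewrite !mxE !lerD2r.
by rewrite mul1r; apply: eq_bigr => i _; rewrite !mxE opprD addrACA subrr addr0.
Qed.

Lemma scales_volume_scaling (t : R) :
  (0 < n)%N -> 0 < t -> scales_volume (fun x => t *: x) (t ^+ n).
Proof.
move=> n0 t0; apply: (scales_volume_box_image _ _
  (fun a _ => t *: a) (fun _ b => t *: b)) => //.
  by rewrite exprn_gt0.
move=> a b ab; split=> [i|x xab i|]; first by rewrite !mxE ler_pM2l.
  by rewrite !mxE !ler_pM2l.
rewrite /box_volume -[in t ^+ n](card_ord n) -prodr_const -big_split /=.
by apply: eq_bigr => i _; rewrite !mxE mulrBr.
Qed.

(** The case i = j, in which coordinate j is multiplied by 1 + c, is included. *)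
Definition transvection (c : R) (i j : 'I_n) x :=
  x + (c * x 0 i) *: delta_mx 0 j.

Lemma transvectionE c i j x k :
  transvection c i j x 0 k = x 0 k + (if k == j then c * x 0 i else 0).
Proof. by rewrite !mxE eqxx /=; case: eqP => _; rewrite ?mulr1 ?mulr0. Qed.

Lemma scales_volume_transvection_diag c j :
  0 < 1 + c -> scales_volume (transvection c j j) (1 + c).
Proof.
move=> c0; have n0 : (0 < n)%N by case: j => m; case: n.
have tE x k : transvection c j j x 0 k = (if k == j then 1 + c else 1) * x 0 k.
  by rewrite transvectionE; case: eqP => [->|_]; ring.
have dk k : 0 < (if k == j then 1 + c else 1) by case: ifP.
apply: (scales_volume_box_image _ _ (fun a _ => transvection c j j a)
  (fun _ b => transvection c j j b)) => // a b ab.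
split=> [i|x xab i|]; first by rewrite !tE ler_pM2l.
  by rewrite !tE !ler_pM2l.
rewrite /box_volume (bigD1 j)//= [in RHS](bigD1 j)//= !tE eqxx -mulrBr mulrA.
by congr (_ * _); apply: eq_bigr => i /negbTE ij; rewrite !tE ij !mul1r.
Qed.

Lemma interval_slice (N : nat) (a b x : R) : (0 < N)%N -> a <= x <= b ->
  exists2 l, (l < N)%N &
    a + l%:R * ((b - a) / N%:R) <= x <= a + l.+1%:R * ((b - a) / N%:R).
Proof.
move=> N0 /andP[ax xb].
have ex : exists l, x <= a + l.+1%:R * ((b - a) / N%:R).
  exists N.-1; rewrite prednK// mulrC mulfVK ?pnatr_eq0 -?lt0n//.
  by rewrite addrC subrK.
case: (ex_minnP ex) => l xl lmin; exists l.
  have -> : N = N.-1.+1 by rewrite prednK.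
  rewrite ltnS; apply: lmin; rewrite prednK// mulrC mulfVK ?pnatr_eq0 -?lt0n//.
  by rewrite addrC subrK.
rewrite xl andbT; case: l xl lmin => [|l] xl lmin; first by rewrite mul0r addr0.
by rewrite leNgt; apply/negP => /ltW/lmin; rewrite ltnn.
Qed.

(** Cut a box into N slices along coordinate i. The image of a slice fits in a
    box whose side along j is longer only by a term of order 1/N, so the excess
    of the total volume tends to 0 as N grows. *)
Lemma scales_volume_transvection c i j :
  i != j -> scales_volume (transvection c i j) 1.
Proof.
move=> ij; have n0 : (0 < n)%N by case: j {ij} => m; case: n.
have [ijF jiF] : (i == j) = false /\ (j == i) = false.
  by rewrite (eq_sym j) (negbTE ij).
apply: scales_volume_boxes => // a b ab; rewrite mul1r.
set w := b 0 i - a 0 i; set wj := b 0 j - a 0 j.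
pose rest := \prod_(k | (k != i) && (k != j)) (b 0 k - a 0 k).
have w0 : 0 <= w by rewrite subr_ge0.
have rest0 : 0 <= rest by apply: prodr_ge0 => k _; rewrite subr_ge0.
have volE : box_volume a b = w * (wj * rest).
  by rewrite /box_volume (bigD1 i)//= (bigD1 j)//= eq_sym.
have slices N : (0 < N)%N -> (volume (transvection c i j @` box a b) <=
    (box_volume a b + 2 * `|c| * w ^+ 2 * rest / N%:R)%:E)%E.
  move=> N0; have N0' : 0 < N%:R :> R by rewrite ltr0n.
  pose h := w / N%:R; have h0 : 0 <= h by rewrite divr_ge0// ltW.
  pose lo l : 'rV[R]_n := \row_k if k == i then a 0 i + l%:R * h else
    if k == j then a 0 j + c * (a 0 i + l%:R * h) - `|c| * h else a 0 k.
  pose hi l : 'rV[R]_n := \row_k if k == i then a 0 i + l.+1%:R * h else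
    if k == j then b 0 j + c * (a 0 i + l%:R * h) + `|c| * h else b 0 k.
  have ch0 : 0 <= `|c| * h by rewrite mulr_ge0.
  apply: le_trans (volume_le_sum_boxes _ N lo hi n0 _ _) _.
  - move=> l k; rewrite !mxE; case: ifP => _.
      by rewrite lerD2l ler_wpM2r// ler_nat.
    case: ifP => _ //; have := ab j; lra.
  - move=> _ [x xab <-].
    have [l lN /andP[lx xl]] := interval_slice N _ _ _ N0 (xab i).
    exists l => //= k; rewrite transvectionE !mxE.
    have [->|ki] := eqVneq k i; first by rewrite ijF addr0; apply/andP; split.
    have [->|kj] := eqVneq k j; last by rewrite addr0.
    have /andP[ajx xbj] := xab j.
    have : `|c * (x 0 i - (a 0 i + l%:R * h))| <= `|c| * h.
      rewrite normrM ler_wpM2l// ger0_norm; last by rewrite subr_ge0.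
      by move: xl; rewrite -natr1 -/w -/h; lra.
    by rewrite ler_norml => /andP[h1 h2]; apply/andP; split; lra.
  have volS l : box_volume (lo l) (hi l) = h * ((wj + 2 * (`|c| * h)) * rest).
    rewrite /box_volume (bigD1 i)//= !mxE eqxx.
    rewrite (bigD1 j)//= ?jiF// !mxE jiF eqxx.
    congr (_ * (_ * _)).
    - by rewrite -natr1; ring.
    - by rewrite /wj; ring.
    - by apply: eq_bigr => k /andP[/negbTE ki /negbTE kj]; rewrite !mxE ki kj.
  rewrite (eq_bigr _ (fun (l : 'I_N) _ => volS l)) sumr_const card_ord.
  rewrite lee_fin volE.
  rewrite -mulr_natl /h le_eqVlt; apply/orP; left; apply/eqP.
  by field; rewrite gt_eqF.
set C := 2 * `|c| * w ^+ 2 * rest in slices.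
have C0 : 0 <= C by rewrite !mulr_ge0// sqr_ge0.
apply/lee_addgt0Pr => e e0.
pose N := (Num.truncn (C / e)).+1.
apply: le_trans (slices N _) _ => //.
rewrite -EFinD lee_fin lerD2l ler_pdivrMr ?ltr0n// mulrC -ler_pdivrMr//.
exact/ltW/truncnS_gt.
Qed.

End Volume.

(** * Volume of a stretched set *)
Section RankOne.
Context {R : realType} {n : nat}.
Implicit Types (x y v : 'rV[R]_n) (A : set 'rV[R]_n) (c : 'I_n -> R).

Lemma eq_scales_volume (f g : 'rV[R]_n -> 'rV[R]_n) (d : R) :
  f =1 g -> scales_volume f d -> scales_volume g d.
Proof. by move=> /funext ->. Qed.

Lemma sum_deltaE c (s : seq 'I_n) (P : pred 'I_n) k :
  (\sum_(i <- s | P i) c i *: delta_mx 0 i : 'rV[R]_n) 0 k =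
  \sum_(i <- s | P i) (if i == k then c i else 0).
Proof.
rewrite summxE; apply: eq_bigr => i _; rewrite !mxE eqxx /= eq_sym.
by case: eqP; rewrite ?mulr1 ?mulr0.
Qed.

Lemma scales_volume_col_shear c j (s : seq 'I_n) :
  scales_volume
    (fun x => x + (\sum_(i <- s | i != j) c i * x 0 i) *: delta_mx 0 j) 1.
Proof.
elim: s => [|i s IH].
  rewrite (_ : (fun _ => _) = id); first exact: scales_volume_id.
  by apply/funext => x; rewrite big_nil scale0r addr0.
have [->|ij] := eqVneq i j.
  by under eq_fun do rewrite big_cons eqxx.
rewrite -(mulr1 1).
apply: eq_scales_volume (scales_volume_comp _ _ _ _ ler01
  (scales_volume_transvection (c i) i j ij) IH) => x /=.
apply/rowP => k; rewrite big_cons ij /transvection !mxE (negbTE ij) andbF.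
by rewrite mulr0 addr0 mulrDl addrA [LHS]addrAC.
Qed.

Lemma scales_volume_row_shear c j (s : seq 'I_n) :
  scales_volume
    (fun x => x + x 0 j *: \sum_(i <- s | i != j) c i *: delta_mx 0 i) 1.
Proof.
elim: s => [|i s IH].
  rewrite (_ : (fun _ => _) = id); first exact: scales_volume_id.
  by apply/funext => x; rewrite big_nil scaler0 addr0.
have [->|ij] := eqVneq i j.
  by under eq_fun do rewrite big_cons eqxx.
rewrite -(mulr1 1); have ji : j != i by rewrite eq_sym.
apply: eq_scales_volume (scales_volume_comp _ _ _ _ ler01
  (scales_volume_transvection (c i) j i ji) IH) => x /=.
rewrite /transvection big_cons ij.
have -> : (x + x 0 j *: \sum_(k <- s | k != j) c k *: delta_mx 0 k) 0 j =
    x 0 j.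
  rewrite mxE [X in _ + X]mxE sum_deltaE big1 ?mulr0 ?addr0// => k /negbTE kj.
  by rewrite kj.
by apply/rowP => k; rewrite !mxE; ring.
Qed.

(** Choose j with y_j nonzero. The shear S 1, which adds multiples of coordinate
    j to the others, sends y_j e_j to y. Conjugation by it turns the map into one
    that changes coordinate j only: multiplication by 1 + t followed by a shear. *)
Lemma scales_volume_rank_one y (t : R) : dotp y y = 1 -> 0 < 1 + t ->
  scales_volume (fun x => x + (t * dotp x y) *: y) (1 + t).
Proof.
move=> yy t0.
have [j yj] : exists j, y 0 j != 0.
  apply/existsP; apply: contraT => /existsPn h.
  have : dotp y y = 0.
    by apply: big1 => i _; have /negPn/eqP -> := h i; rewrite mul0r.
  by rewrite yy => /eqP; rewrite oner_eq0.
pose S e x : 'rV[R]_n := x + x 0 j *: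
  \sum_(i <- index_enum 'I_n | i != j) (e * (y 0 i / y 0 j)) *: delta_mx 0 i.
pose C x : 'rV[R]_n := x + (\sum_(i <- index_enum 'I_n | i != j)
  (t * y 0 j * y 0 i) * x 0 i) *: delta_mx 0 j.
have SS e : scales_volume (S e) 1 by exact: scales_volume_row_shear.
have SC : scales_volume C 1 by exact: scales_volume_col_shear.
have SE e x k : S e x 0 k =
    if k == j then x 0 j else x 0 k + x 0 j * (e * (y 0 k / y 0 j)).
  rewrite /S mxE [X in _ + X]mxE sum_deltaE -big_mkcondr /=.
  have [->|kj] := eqVneq k j.
    by rewrite big1 ?mulr0 ?addr0// => i /andP[/negbTE ->].
  rewrite (big_pred1 k) // => i.
  by rewrite /= andb_idl// => /eqP ->.
have -> : (fun x => x + (t * dotp x y) *: y) =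
    (S 1 \o C) \o (transvection t j j \o S (-1)).
  apply/funext => x /=.
  set w := S (-1) x; set w' := transvection t j j w.
  have wj : w 0 j = x 0 j by rewrite SE eqxx.
  have w'j : w' 0 j = (1 + t) * x 0 j.
    rewrite /w' transvectionE eqxx wj; ring.
  have Cj : C w' 0 j = x 0 j + t * y 0 j * dotp x y.
    rewrite /C mxE [X in _ + X]mxE [delta_mx _ _ _ _]mxE !eqxx mulr1 w'j.
    have -> : \sum_(i <- index_enum 'I_n | i != j) t * y 0 j * y 0 i * w' 0 i =
        t * y 0 j * (dotp x y - x 0 j / y 0 j).
      have -> : dotp x y - x 0 j / y 0 j =
          \sum_(i | i != j) x 0 i * y 0 i -
          x 0 j / y 0 j * \sum_(i | i != j) y 0 i * y 0 i.
        have dj u : dotp u y = u 0 j * y 0 j + \sum_(i | i != j) u 0 i * y 0 i.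
          by rewrite /dotp (bigD1 j).
        have -> : \sum_(i | i != j) y 0 i * y 0 i = 1 - y 0 j * y 0 j.
          by rewrite -yy dj addrC addKr.
        rewrite dj.
        by field.
      rewrite !mulr_sumr -sumrB mulr_sumr; apply: eq_bigr => i ij.
      by rewrite transvectionE SE (negbTE ij); field.
    by field.
  apply/rowP => k; rewrite SE Cj.
  have [->|kj] := eqVneq k j; first by rewrite !mxE; ring.
  have -> : C w' 0 k = w' 0 k.
    rewrite /C mxE [X in _ + X]mxE [delta_mx _ _ _ _]mxE (negbTE kj) andbF.
    by rewrite mulr0 addr0.
  rewrite /w' transvectionE /w SE (negbTE kj) !mxE.
  by field.
rewrite (_ : 1 + t = (1 * 1) * ((1 + t) * 1)); last by ring.
apply: scales_volume_comp; first by rewrite mulr1.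
  exact: scales_volume_comp.
apply: scales_volume_comp => //; first exact: ltW.
exact: scales_volume_transvection_diag.
Qed.

(** For a unit vector y, this multiplies by a along y and by b orthogonally
    to y. *)
Definition stretch (a b : R) y x : 'rV[R]_n :=
  b *: x + ((a - b) * dotp x y) *: y.

(** The determinant is a b^(n-1); the bound is obtained by applying
    the inverse map to the stretched set. *)
Lemma volume_stretch A v y (a b : R) : (0 < n)%N -> dotp y y = 1 ->
  0 < a -> 0 < b -> 1 <= a * b ^+ n.-1 ->
  (volume A <= volume [set (v + stretch a b y x)%R | x in A])%E.
Proof.
move=> n0 yy a0 b0 ab1; set E := [set _ | x in A].
pose t := b / a - 1; have t0 : 0 < 1 + t by rewrite addrC subrK divr_gt0.
have bV0 : 0 < b^-1 by rewrite invr_gt0.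
have := scales_volume_comp _ _ _ _ (exprn_ge0 n (ltW bV0))
  (scales_volume_scaling b^-1 n0 bV0) (scales_volume_comp _ _ _ _ (ltW t0)
  (scales_volume_rank_one y t yy t0) (scales_volume_translation (- v) n0)).
move=> /(_ E); rewrite [X in (volume X <= _)%E](_ : _ = A); last first.
  rewrite /E image_comp -[RHS]image_id; apply: eq_imagel => x _ /=.
  have -> z : v + z - v = z by rewrite addrC addrA addNr add0r.
  rewrite /stretch dotpDl !dotpZl yy; apply/rowP => k; rewrite !mxE /t.
  by field; rewrite !gt_eqF.
move/le_trans; apply; apply: gee_pMl => //; first exact: volume_ge0.
rewrite lee_fin mulr1 /t addrC subrK exprVn -[n in b ^+ n](prednK n0) exprS.
rewrite (_ : _ * _ = (a * b ^+ n.-1)^-1); last first.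
  by field; rewrite expf_eq0 !gt_eqF// andbF.
by rewrite invf_le1// (lt_le_trans ltr01).
Qed.

End RankOne.

(** * A convex body in John's position is bounded by 4n + 1 *)
Section John.
Context {R : realType} {n : nat}.
Implicit Types (x y v w u : 'rV[R]_n) (K : set 'rV[R]_n).

Lemma eballE x : eball x <-> dotp x x <= 1.
Proof.
by rewrite /eball /enorm /= -[X in _ <= X]sqrtr1 ler_sqrt.
Qed.

Lemma eball0 : eball (0 : 'rV[R]_n).
Proof. by apply/eballE; rewrite dotp0l ler01. Qed.

Lemma sqr_enorm x : enorm x ^+ 2 = dotp x x.
Proof. by rewrite sqr_sqrtr// dotp_ge0. Qed.

Lemma Bernoulli (k : R) m : 0 <= k <= 1 -> 1 - m%:R * k <= (1 - k) ^+ m.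
Proof.
move=> /andP[k0 k1]; elim: m => [|m IH]; first by rewrite mul0r subr0 expr0.
rewrite exprS -natr1.
have : (1 - k) * (1 - m%:R * k) <= (1 - k) * (1 - k) ^+ m.
  by rewrite ler_wpM2l// subr_ge0.
have : 0 <= m%:R * k * k :> R by rewrite !mulr_ge0.
lra.
Qed.

Lemma dotp_stretch (a b : R) y u w :
  dotp u (stretch a b y w) = dotp (stretch a b y u) w.
Proof. by rewrite /stretch dotpDr dotpDl !dotpZr !dotpZl (dotpC w y); ring. Qed.

Lemma dotp_stretch_stretch (a b : R) y u : dotp y y = 1 ->
  dotp (stretch a b y u) (stretch a b y u) =
  b ^+ 2 * (dotp u u - dotp u y ^+ 2) + a ^+ 2 * dotp u y ^+ 2.
Proof.
move=> yy; rewrite -dotp_stretch /stretch !(dotpDr, dotpZr, dotpDl, dotpZl) yy.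
by ring.
Qed.

Lemma ellipsoid_stretch (a b : R) v y : dotp y y = 1 -> 0 < a -> 0 < b ->
  ellipsoid [set v + stretch a b y w | w in @eball R n].
Proof.
move=> yy a0 b0; pose Y := y^T *m y.
have YE w : w *m Y = dotp w y *: y.
  rewrite mulmxA (_ : w *m y^T = (dotp w y)%:M) ?mul_scalar_mx//.
  apply/rowP => i; rewrite ord1 !mxE eqxx mulr1n.
  by apply: eq_bigr => j _; rewrite mxE.
have YY : Y *m Y = Y by rewrite {1}/Y -mulmxA YE yy scale1r.
exists v, (b%:M + (a - b) *: Y); split.
  apply: (proj1 (@mulmx1_unit _ _ _ (b^-1%:M + (b - a) / (a * b) *: Y) _)).
  rewrite mulmxDl !mulmxDr -!scalemxAl -!scalemxAr YY -scalar_mxM.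
  rewrite mulfV ?gt_eqF//.
  rewrite mul_scalar_mx mul_mx_scalar !scalerA -addrA -!scalerDl.
  set c := (X in X *: Y).
  have -> : c = 0 by rewrite /c; field; rewrite !gt_eqF.
  by rewrite scale0r addr0.
apply: eq_imagel => w _.
by rewrite mulmxDr mul_mx_scalar -scalemxAr YE scalerA.
Qed.

(** A half-space that contains B and r y, with normal u and offset c, satisfies
    |u| <= c and r <u,y> <= c. It must contain the ellipsoid, whose support
    function at u is s + |q|, where s = <u,y> and q is the stretched vector u.
    The two constraints give |q|^2 <= (c - s)^2: up to estimates that use
    (1 - k)^2 <= 1 - k, the difference factors as (c + s)(k c - (2 + k) s),
    and the threshold 2/k + 1 on r is what makes the second factor
    nonnegative. *)
Lemma stretched_ball_sub K (k r : R) y : compact K ->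
  convex_set (K : set (convex_lmodType 'rV[R]_n)) -> @eball R n `<=` K ->
  dotp y y = 1 -> 0 < k <= 1 -> 2 / k + 1 <= r -> K (r *: y) ->
  [set y + stretch 2 (1 - k) y w | w in @eball R n] `<=` K.
Proof.
move=> cK vK BK yy /andP[k0 k1] kr Kx _ [w /eballE ww <-].
apply: contrapT => nKz.
have K0 : K !=set0 by exists (r *: y).
have [u [c [uc]]] := strict_separation _ _ cK vK K0 nKz.
rewrite dotpDr dotp_stretch.
set q := stretch _ _ _ _; set s := dotp u y => lt_c.
have rs : r * s <= c by have := uc _ Kx; rewrite dotpZr.
set U := dotp u u; have U0 : 0 <= U by exact: dotp_ge0.
have sU : s ^+ 2 <= U by have := Cauchy_Schwarz_dotp u y; rewrite yy mulr1.
have c0 : 0 <= c.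
  by have := uc _ (BK _ eball0); rewrite dotp0r.
have Uc : U <= c ^+ 2.
  have [u0|un0] := eqVneq u 0.
    by rewrite /U u0 dotp0l sqr_ge0.
  have e0 : 0 < enorm u by rewrite sqrtr_gt0 dotp_gt0.
  have : K ((enorm u)^-1 *: u).
    apply: BK; apply/eballE; rewrite dotpZl dotpZr -sqr_enorm expr2.
    by rewrite !mulKf ?mulVf ?gt_eqF.
  move/uc; rewrite dotpZr -sqr_enorm.
  have -> : (enorm u)^-1 * enorm u ^+ 2 = enorm u by field; rewrite gt_eqF.
  by move=> uc'; rewrite /U -sqr_enorm ler_sqr ?nnegrE// ltW.
have sc : s ^+ 2 <= c ^+ 2 by exact: le_trans Uc.
have /andP[sc1 sc2] : - c <= s <= c.
  by rewrite -ler_norml -ler_sqr ?nnegrE// real_normK// num_real.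
have ks : (2 + k) * s <= k * c.
  have kr' : 2 + k <= k * r.
    have := ler_wpM2l (ltW k0) kr; rewrite mulrDr mulrCA mulfV ?gt_eqF//; lra.
  have [s0|s0] := ltrP s 0; first by nra.
  have : (2 + k) * s <= k * r * s by rewrite ler_wpM2r.
  have : k * (r * s) <= k * c by rewrite ler_wpM2l// ltW.
  lra.
have qq : dotp q q <= (c - s) ^+ 2.
  rewrite dotp_stretch_stretch// -/U -/s.
  have h1 : (1 - k) ^+ 2 * (U - s ^+ 2) <= (1 - k) * (c ^+ 2 - s ^+ 2).
    apply: ler_pM; rewrite ?sqr_ge0 ?subr_ge0//; last by lra.
    nra.
  have h2 : 0 <= (c + s) * (k * c - (2 + k) * s) by rewrite mulr_ge0; lra.
  lra.
have qw : dotp q w ^+ 2 <= (c - s) ^+ 2.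
  apply: le_trans (Cauchy_Schwarz_dotp q w) _.
  apply: le_trans qq; rewrite -[leRHS]mulr1 ler_wpM2l//.
  exact: dotp_ge0.
have : `|dotp q w| <= c - s.
  by rewrite -ler_sqr ?nnegrE ?subr_ge0// real_normK// num_real.
by rewrite ler_norml => /andP[_]; lra.
Qed.

(** Otherwise the ball stretched towards x by stretched_ball_sub, with
    k = 1/(2n), would be a second ellipsoid of maximal volume: Bernoulli's
    inequality gives 2 (1 - k)^(n-1) >= 1, and it contains 3 y, of norm 3. *)
Lemma john_position_bounded K x : (0 < n)%N -> convex_body K ->
  john_position K -> K x -> enorm x < 4 * n%:R + 1.
Proof.
move=> n0 [cK vK _] [[_ BK maxB] uniqB] Kx.
rewrite ltNge; apply/negP => xbig.
set r := enorm x in xbig.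
have r0 : 0 < r by apply: lt_le_trans xbig; rewrite ltr_wpDl ?mulr_ge0.
pose y := r^-1 *: x.
have xE : x = r *: y by rewrite scalerA mulfV ?gt_eqF// scale1r.
have yy : dotp y y = 1.
  by rewrite dotpZl dotpZr -sqr_enorm -/r; field; rewrite gt_eqF.
have n0' : 1 <= n%:R :> R by rewrite ler1n.
pose k : R := (2 * n%:R)^-1.
have k0 : 0 < k by rewrite invr_gt0; lra.
have nk : n%:R * k = 2^-1 by rewrite /k; field; lra.
have k1 : k <= 2^-1 by nra.
set E := [set y + stretch 2 (1 - k) y w | w in @eball R n].
have b0 : 0 < 1 - k by lra.
have EK : E `<=` K.
  apply: (stretched_ball_sub K k r) => //; first by lra.
    by rewrite /k invrK; lra.
  by rewrite -xE.
have volE : (volume (@eball R n) <= volume E)%E.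
  apply: volume_stretch => //.
  have := Bernoulli k n.-1; rewrite (_ : 0 <= k <= 1); last by lra.
  move=> /(_ isT); have : n.-1%:R * k <= n%:R * k.
    by rewrite ler_wpM2r ?(ltW k0)// ler_nat leq_pred.
  lra.
have ellE : ellipsoid E by apply: ellipsoid_stretch.
have EB : @eball R n = E.
  apply: uniqB; split => // E' ellE' E'K.
  by apply: le_trans (maxB _ ellE' E'K) volE.
have : E (3 *: y).
  exists y; first by apply/eballE; rewrite yy.
  by rewrite /stretch yy; apply/rowP => i; rewrite !mxE; ring.
rewrite -EB => /eballE; rewrite dotpZl dotpZr yy; lra.
Qed.

End John.

(** * Facets of an intersection of half-spaces *)
Section Facets.
Context {R : realType} {n : nat}.
Implicit Types (x y u : 'rV[R]_n) (P F : set 'rV[R]_n).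

Lemma dotp_sumr (I : finType) u (f : I -> 'rV[R]_n) :
  dotp u (\sum_i f i) = \sum_i dotp u (f i).
Proof.
rewrite /dotp exchange_big /=; apply: eq_bigr => k _.
by rewrite summxE mulr_sumr.
Qed.

Definition hyperplane_dir u : {vspace 'rV[R]_n} :=
  lker (linfun (mulmxr u^T : 'rV[R]_n -> 'rV[R]_1)).

Lemma mem_hyperplane_dir u x : (x \in hyperplane_dir u) = (dotp u x == 0).
Proof.
rewrite memv_ker lfunE /=; apply/eqP/eqP => [/rowP/(_ 0)|ux].
  by rewrite !mxE => <-; apply: eq_bigr => i _; rewrite mxE mulrC.
apply/rowP => i; rewrite ord1 !mxE -[RHS]ux.
by apply: eq_bigr => j _; rewrite mxE mulrC.
Qed.

Lemma dim_hyperplane_dir u : u != 0 -> (\dim (hyperplane_dir u) < n)%N.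
Proof.
move=> u0; rewrite ltnNge; apply/negP => dimn.
have : hyperplane_dir u == fullv.
  by rewrite eqEdim subvf dimvf dim_matrix mul1r.
move=> /eqP E; have : u \in hyperplane_dir u by rewrite E memvf.
by rewrite mem_hyperplane_dir gt_eqF// dotp_gt0.
Qed.

Lemma ball_not_codim1 F : (0 < n)%N -> @eball R n `<=` F -> ~ has_dim F n.-1.
Proof.
move=> n0 BF [x0 [V [_ dimV FV _]]].
have Vx0 : x0 \in V by rewrite -rpredN -[- x0]add0r; exact/FV/BF/eball0.
have Vd i : delta_mx 0 i \in V.
  rewrite -[delta_mx 0 i](subrK x0) rpredD//; apply/FV/BF/eballE.
  by rewrite dotp_delta mxE !eqxx.
have Vfull : V == fullv.
  rewrite eqEsubv subvf; apply/subvP => x _; rewrite (row_sum_delta x).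
  by apply: rpred_sum => i _; exact: rpredZ.
move: dimV; rewrite (eqP Vfull) dimvf dim_matrix mul1r => nE.
by move: (ltnn n); rewrite [X in (X < _)%N]nE prednK// leqnn.
Qed.

(** A point at which all constraints are strict can be moved in the direction u
    without leaving the intersection, hence without leaving the half-space. *)
Lemma slack_point_below_support (m : nat) (w : 'I_m -> 'rV[R]_n) (d : 'I_m -> R)
    u b z : u != 0 ->
  [set x | forall i, dotp (w i) x <= d i] `<=` halfspace u b ->
  (forall i, dotp (w i) z < d i) -> dotp u z < b.
Proof.
move=> u0 Pu zlt.
(* 1/T is a step that respects every constraint, the slack at z being positive. *)
pose T := 1 + \sum_i `|dotp (w i) u| / (d i - dotp (w i) z).
have terms i : 0 <= `|dotp (w i) u| / (d i - dotp (w i) z).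
  by rewrite divr_ge0// ltW// subr_gt0.
have T0 : 0 < T by rewrite ltr_wpDr// sumr_ge0.
have : halfspace u b (z + T^-1 *: u).
  apply: Pu => i /=; rewrite dotpDr dotpZr -lerBrDl mulrC ler_pdivrMr//.
  apply: le_trans (ler_norm _) _.
  have := zlt i; rewrite -subr_gt0 => di.
  rewrite mulrC -ler_pdivrMr// /T (bigD1 i)//= addrCA lerDl addr_ge0//.
  by rewrite sumr_ge0.
rewrite /halfspace /= dotpDr dotpZr; apply: lt_le_trans.
by rewrite ltrDl mulr_gt0 ?invr_gt0// dotp_gt0.
Qed.

(** If every constraint were strict at some point of the face, all of them would
    be strict at the average of these points, which still lies on the
    supporting hyperplane. *)
Lemma facet_active (m : nat) (w : 'I_m -> 'rV[R]_n) (d : 'I_m -> R) F u b x0 :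
  let P := [set x | forall i, dotp (w i) x <= d i] in
  u != 0 -> P `<=` halfspace u b -> F = P `&` [set x | dotp u x = b] -> F x0 ->
  exists i, forall x, F x -> dotp (w i) x = d i.
Proof.
move=> P u0 Pu FE Fx0; apply: contrapT => nact.
have FP x : F x -> P x by rewrite FE => -[].
have Fu x : F x -> dotp u x = b by rewrite FE => -[].
have [p pP] : {p & forall i, F (p i) /\ dotp (w i) (p i) < d i}.
  apply: (@choice _ _ (fun i x => F x /\ dotp (w i) x < d i)) => i.
  apply: contrapT => ni; apply: nact; exists i => x Fx.
  apply/eqP; rewrite eq_le (FP _ Fx)/= leNgt; apply/negP => lt_d.
  by apply: ni; exists x.
(* Including x0 keeps the average defined when there are no constraints. *)
pose z := m.+1%:R^-1 *: (x0 + \sum_i p i).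
have m0 : 0 < m.+1%:R :> R by rewrite ltr0n.
have sumconst (t : R) : m.+1%:R * t = t + \sum_(i < m) t.
  by rewrite sumr_const card_ord mulr_natl mulrS.
suff : dotp u z < b.
  rewrite /z dotpZr dotpDr dotp_sumr (Fu _ Fx0).
  rewrite (eq_bigr (fun=> b)) => [|i _]; last exact/Fu/(pP i).1.
  by rewrite -sumconst mulKf ?ltxx// gt_eqF.
apply: (slack_point_below_support _ _ _ _ _ _ u0 Pu) => i.
rewrite /z dotpZr mulrC ltr_pdivrMr// [ltRHS]mulrC sumconst dotpDr dotp_sumr.
apply: ler_ltD; first exact: (FP _ Fx0).
rewrite (bigD1 i)//= [ltRHS](bigD1 i)//=.
apply: ltr_leD; first exact: (pP i).2.
by apply: ler_sum => k _; exact: (FP _ (pP k).1).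
Qed.

(** A facet F lies in the hyperplane of some constraint i. By dimension, the
    direction of its affine hull is all of the direction of that hyperplane, so F
    contains every point of P on it. Hence i determines F. *)
Lemma facets_le_constraints (m : nat) (w : 'I_m -> 'rV[R]_n) (d : 'I_m -> R) :
  let P := [set x | forall i, dotp (w i) x <= d i] in
  (0 < n)%N -> (forall i, w i != 0) -> @eball R n `<=` P ->
  exists2 k, (facets P #= `I_k)%card & (k <= m)%N.
Proof.
move=> P n0 w0 BP.
pose G i := P `&` [set x | dotp (w i) x = d i].
have facetsG : facets P `<=` G @` [set: 'I_m].
  move=> F [[u [b [Pu FE]]] dimF].
  have [x0 [V [Fx0 dimV FV Vmin]]] := dimF.
  (* The definition of a face allows u = 0, and then F is P itself. *)
  have [u0|u0] := eqVneq u 0.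
    have BF : @eball R n `<=` F.
      move=> x /BP Px; rewrite FE; split => //=.
      by move: Fx0; rewrite FE => -[_ /=]; rewrite u0 !dotp0l.
    by case: (ball_not_codim1 _ n0 BF dimF).
  have [i Fi] := facet_active m w d F u b x0 u0 Pu FE Fx0.
  have Vi : (V <= hyperplane_dir (w i))%VS.
    apply: Vmin => x Fx; rewrite mem_hyperplane_dir dotpDr dotpNr.
    by rewrite !Fi// subrr.
  have Vu : (V <= hyperplane_dir u)%VS.
    apply: Vmin => x; move: Fx0; rewrite FE => -[_ /= ux0] [_ /= ux].
    by rewrite mem_hyperplane_dir dotpDr dotpNr ux ux0 subrr.
  have VE : V = hyperplane_dir (w i).
    apply/eqP; rewrite eqEdim Vi dimV -ltnS prednK//.
    exact: dim_hyperplane_dir.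
  exists i => //; apply/seteqP; split => [x [Px /= wx]|x Fx]; last first.
    by split; [move: Fx; rewrite FE => -[]|exact: Fi].
  rewrite FE; split => //=.
  have : x - x0 \in V.
    by rewrite VE mem_hyperplane_dir dotpDr dotpNr wx Fi// subrr.
  move/(subvP Vu); rewrite mem_hyperplane_dir dotpDr dotpNr subr_eq0 => /eqP ->.
  by move: Fx0; rewrite FE => -[].
have le_m : (facets P #<= `I_m)%card.
  apply: card_le_trans (subset_card_le facetsG) _.
  apply: card_le_trans (card_image_le _ _) _.
  by have := @card_II m; rewrite card_eq_le => /andP[].
have [k Pk] : finite_set (facets P) by apply: card_le_finite le_m _.
exists k => //; rewrite -card_le_II; apply: card_le_trans le_m.
by move: Pk; rewrite card_eq_le => /andP[].
Qed.

End Facets.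

(** * Approximation by a polytope with normals in a grid *)
Section Approximation.
Context {R : realType} {n : nat}.
Implicit Types (x y u : 'rV[R]_n) (K : set 'rV[R]_n).

Lemma coord_le_norm x i : `|x 0 i| <= `|x|.
Proof.
rewrite [leRHS]/Num.norm /= mx_normrE; apply/bigmax_geP; right => /=.
by exists (0, i).
Qed.

Lemma norm_attained x : x != 0 -> exists i, `|x 0 i| = `|x|.
Proof.
move=> x0; have [|[i j]] := @mx_norm_neq0 _ _ _ x.
  by rewrite -[mx_norm x]/`|x| normr_eq0.
by rewrite /= ord1 => e; exists j; rewrite -e.
Qed.

(** The odd numerators keep every grid vector away from 0, so that each of them
    defines a half-space. *)
Definition grid (q : nat) (f : {ffun 'I_n -> 'I_q.*2}) : 'rV[R]_n :=
  \row_i ((f i).*2.+1%:R / q.*2%:R - 1).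

Lemma grid_neq0 q f : (0 < n)%N -> grid q f != 0.
Proof.
move=> n0; apply/eqP => /rowP/(_ (Ordinal n0)); rewrite !mxE => /eqP.
have q0 : (0 < q.*2)%N by case: (f (Ordinal n0)) => k; exact: leq_trans.
rewrite subr_eq0 -[eqbRHS](@divff _ q.*2%:R) ?pnatr_eq0 -?lt0n//.
rewrite (inj_eq (mulIf _)) ?invr_eq0 ?pnatr_eq0 -?lt0n// eqr_nat.
by move=> /eqP/(congr1 odd) /=; rewrite !odd_double.
Qed.

Lemma grid_le1 q f i : `|grid q f 0 i| <= 1.
Proof.
rewrite mxE; have fq := ltn_ord (f i).
have q0 : 0 < q.*2%:R :> R by rewrite ltr0n; exact: leq_trans fq.
have : (f i).*2.+1%:R / q.*2%:R <= 2 :> R.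
  rewrite ler_pdivrMr// -natrM ler_nat mul2n ltnW//.
  by rewrite ltn_Sdouble.
have : 0 <= (f i).*2.+1%:R / q.*2%:R :> R by rewrite divr_ge0.
by rewrite ler_norml => h1 h2; apply/andP; split; lra.
Qed.

Lemma grid_net q u : (0 < q)%N -> (forall i, `|u 0 i| <= 1) ->
  exists f, forall i, `|(u - grid q f) 0 i| <= q%:R^-1.
Proof.
move=> q0 u1; have qR : 0 < q%:R :> R by rewrite ltr0n.
have q2 : (0 < q.*2)%N by rewrite double_gt0.
have [f fP] : {f : 'I_n -> 'I_q.*2 & forall i,
    `|u 0 i - ((f i).*2.+1%:R / q.*2%:R - 1)| <= q%:R^-1}.
  apply: (@choice _ _ (fun i (k : 'I_q.*2) =>
    `|u 0 i - (k.*2.+1%:R / q.*2%:R - 1)| <= q%:R^-1)) => i.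
  have := u1 i; rewrite ler_norml => /(interval_slice _ _ _ _ q2)[k kq].
  rewrite (_ : (1 - -1) / q.*2%:R = q%:R^-1); last first.
    by rewrite -mul2n natrM; field; rewrite gt_eqF.
  rewrite -natr1 => h; exists (Ordinal kq) => /=.
  rewrite (_ : k.*2.+1%:R / q.*2%:R = k%:R * q%:R^-1 + q%:R^-1 / 2); last first.
    by rewrite -natr1 -!mul2n !natrM; field; rewrite gt_eqF.
  have : 0 < q%:R^-1 :> R by rewrite invr_gt0.
  by rewrite ler_norml; move: h => /andP[h1 h2] h3; apply/andP; split; lra.
by exists (finfun f) => i; rewrite !mxE ffunE.
Qed.

(** The witness is plus or minus a basis vector. It is used both as a point of
    the unit ball and as a direction that reads off |u_i|. *)
Lemma signed_unit u i : exists v,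
  [/\ eball v, forall j, `|v 0 j| <= 1 & dotp u v = `|u 0 i|].
Proof.
exists (Num.sg (u 0 i) *: delta_mx 0 i).
have sg1 : `|Num.sg (u 0 i)| <= 1 by rewrite normr_sg; case: eqP.
split; last by rewrite dotpZr dotp_delta -normrEsg.
  apply/eballE; rewrite dotpZl dotpZr dotp_delta mxE !eqxx mulr1 -expr2.
  by rewrite -(real_normK (num_real _)) expr_le1.
move=> j; rewrite !mxE eqxx normrM -[leRHS]mulr1 ler_pM//.
by case: eqP => _; rewrite ?normr1 ?normr0.
Qed.

(** The sup norm is used for directions and points alike, so that the error of
    replacing a direction by a grid vector is controlled coordinatewise. *)
Lemma grid_polytope K (r : R) (q : nat) : (0 < n)%N -> compact K ->
  convex_set (K : set (convex_lmodType 'rV[R]_n)) -> @eball R n `<=` K ->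
  (forall x i, K x -> `|x 0 i| <= r) -> 1 <= r ->
  3 * n%:R ^+ 2 * r <= q%:R ->
  exists P, [/\ polytope P,
    exists2 k, (facets P #= `I_k)%card & (k <= q.*2 ^ n)%N,
    dilate 2^-1 P `<=` K & K `<=` P].
Proof.
move=> n0 cK vK BK Kr r1 qr.
have nR : 1 <= n%:R :> R by rewrite ler1n.
have nr : 1 <= n%:R * r by rewrite -[leLHS]mulr1 ler_pM.
have n2r : n%:R * r <= n%:R ^+ 2 * r.
  by rewrite ler_wpM2r ?(le_trans ler01)// ler_eXnr.
have qR : 0 < q%:R :> R by lra.
have q0 : (0 < q)%N by rewrite -(ltr0n R).
have K0 : K !=set0 by exists 0; exact/BK/eball0.
pose h f := sup (dotp (grid q f) @` K).
have gK f x : K x -> dotp (grid q f) x <= n%:R * (1 * r).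
  by move=> Kx; apply: dotp_le_sup => i; [exact: grid_le1|exact: Kr].
have hsup f : has_sup (dotp (grid q f) @` K).
  split; first exact: image_nonempty.
  by exists (n%:R * (1 * r)) => _ [x Kx <-]; exact: gK.
have h_ge f x : K x -> dotp (grid q f) x <= h f.
  by move=> Kx; apply: sup_upper_bound => //; exists x.
have h_le f c : (forall x, K x -> dotp (grid q f) x <= c) -> h f <= c.
  move=> gc; apply: ge_sup; first exact: (hsup f).1.
  by move=> _ [x Kx <-]; exact: gc.
pose m := #|{ffun 'I_n -> 'I_q.*2}|.
pose w (i : 'I_m) := grid q (enum_val i).
pose d (i : 'I_m) := h (enum_val i).
pose P := [set x | forall i, dotp (w i) x <= d i].
have Pf x f : P x -> dotp (grid q f) x <= h f.
  by move=> /(_ (enum_rank f)); rewrite /w /d enum_rankK.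
have KP : K `<=` P by move=> x Kx i; exact: h_ge.
(* The first error term comes from K, for the support function, and the second
   from the point x. *)
have near_grid (v : 'rV[R]_n) x (X : R) : (forall i, `|v 0 i| <= 1) -> P x ->
    (forall i, `|x 0 i| <= X) ->
    forall c : R, (forall p, K p -> dotp v p <= c) ->
    dotp v x <= c + n%:R * (q%:R^-1 * r) + n%:R * (q%:R^-1 * X).
  move=> v1 Px xX c vc; have [f fv] := grid_net q v q0 v1.
  have -> : dotp v x = dotp (grid q f) x + dotp (v - grid q f) x.
    by rewrite dotpDl dotpNl; ring.
  apply: lerD; last exact: dotp_le_sup.
  apply: le_trans (Pf x f Px) _; apply: h_le => p Kp.
  have -> : dotp (grid q f) p = dotp v p + dotp (- (v - grid q f)) p.
    by rewrite dotpNl !dotpDl dotpNl; ring.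
  apply: lerD; first exact: vc.
  apply: dotp_le_sup => i; last exact: Kr.
  by rewrite mxE normrN.
have nq : n%:R * (q%:R^-1 * r) + 2 * n%:R ^+ 2 * r / q%:R <= 1.
  rewrite (_ : _ + _ = (n%:R * r + 2 * n%:R ^+ 2 * r) / q%:R); last by ring.
  by rewrite ler_pdivrMr// mul1r; lra.
(* P must be bounded before the error term at x can be: x is tested against a
   basis direction, and the term n |x| / q is absorbed in the left-hand side. *)
have Pnorm x : P x -> `|x| <= 2 * n%:R * r.
  move=> Px; have [->|x0] := eqVneq x 0.
    by rewrite normr0 !mulr_ge0//; lra.
  have [i xi] := norm_attained x x0.
  have [v [_ v1 vx]] := signed_unit x i.
  have vK' p : K p -> dotp v p <= n%:R * (1 * r).
    by move=> Kp; apply: dotp_le_sup => // j; exact: Kr.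
  have := near_grid v x `|x| v1 Px (coord_le_norm x) _ vK'.
  rewrite dotpC vx xi.
  have q3 : 3 * n%:R <= q%:R :> R.
    apply: le_trans qr; rewrite expr2 -mulrA ler_wpM2l//.
    by rewrite -[leLHS]mulr1 -mulrA ler_wpM2l//; lra.
  have nq3 : n%:R / q%:R <= 3^-1 :> R by rewrite ler_pdivrMr//; lra.
  have q13 : q%:R^-1 <= 3^-1 :> R by rewrite lef_pV2 ?posrE//; lra.
  have : n%:R / q%:R * `|x| <= 3^-1 * `|x| by rewrite ler_wpM2r.
  have : q%:R^-1 * (n%:R * r) <= 3^-1 * (n%:R * r) by rewrite ler_wpM2r//; lra.
  lra.
exists P; split.
- split.
    apply: bounded_closed_compact.
      exists (2 * n%:R * r); split; first exact: num_real.
      by move=> M MX x Px; apply: le_trans (Pnorm x Px) (ltW MX).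
    rewrite (_ : P = \bigcap_i (dotp (w i) @^-1` [set t | t <= d i])).
      apply: closed_bigI => i _; apply: closed_comp; last exact: closed_le.
      by move=> x _; exact: continuous_dotp.
    by apply/seteqP; split => [x Px i _|x Px i]; exact: Px.
  by exists m, w, d; split => // i; exact: grid_neq0.
- have [k Pk km] := facets_le_constraints m w d n0 (fun i => grid_neq0 _ _ n0)
    (subset_trans BK KP).
  exists k => //; apply: leq_trans km _.
  by rewrite /m card_ffun !card_ord.
- move=> _ [x Px <-]; apply: contrapT => nKx.
  have [u [c [uc]]] := strict_separation _ _ cK vK K0 nKx.
  rewrite dotpZr => cux.
  have c0 : 0 <= c.
    by have := uc _ (BK _ eball0); rewrite dotp0r.
  have u0 : u != 0.
    by apply: contraTneq cux => ->; rewrite dotp0l mulr0 -leNgt.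
  have s0 : 0 < `|u| by rewrite normr_gt0.
  pose v := `|u|^-1 *: u.
  have v1 i : `|v 0 i| <= 1.
    rewrite mxE normrM normfV normr_id mulrC ler_pdivrMr// mul1r.
    exact: coord_le_norm.
  have vc p : K p -> dotp v p <= c / `|u|.
    by move=> Kp; rewrite dotpZl mulrC ler_pM2r ?invr_gt0//; exact: uc.
  have c1 : 1 <= c / `|u|.
    have [i ui] := norm_attained u u0; have [e [Be _ ue]] := signed_unit u i.
    by rewrite ler_pdivlMr// mul1r -ui -ue; exact/uc/BK.
  have := near_grid v x (2 * n%:R * r) v1 Px _ _ vc.
  move=> /(_ (fun i => le_trans (coord_le_norm x i) (Pnorm x Px))).
  have : 2 * (c / `|u|) < dotp v x.
    rewrite dotpZl mulrA ltr_pdivrMr// mulrAC mulVf ?gt_eqF//; lra.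
  have : n%:R * (q%:R^-1 * (2 * n%:R * r)) = 2 * n%:R ^+ 2 * r / q%:R by ring.
  lra.
- exact: KP.
Qed.

End Approximation.

Theorem corollary1p6 (R : realType) :
  exists c : R, 0 < c /\
  exists N : nat, forall n : nat, (N <= n)%N ->
  forall K : set 'rV[R]_n, convex_body K -> john_position K ->
  exists P : set 'rV[R]_n,
    [/\ polytope P,
        exists m : nat, (facets P #= `I_m)%card /\
          m%:R <= expR (c * ln (n%:R) * n%:R),
        dilate (2^-1) P `<=` K &
        K `<=` P].
Proof.
exists 8; split => //; exists 2%N => n n2 K bodyK johnK.
have n0 : (0 < n)%N by exact: leq_trans n2.
have nR : 1 <= n%:R :> R by rewrite ler1n.
have [cK vK _] := bodyK; have [[_ BK _] _] := johnK.
(* The bound r = 5 n exceeds 4 n + 1, and q = 15 n^3 is 3 n^2 r. *)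
have Kr x i : K x -> `|x 0 i| <= 5 * n%:R.
  move=> Kx; have := john_position_bounded K x n0 bodyK johnK Kx.
  suff : `|x 0 i| <= enorm x by lra.
  rewrite -ler_sqr ?nnegrE ?sqrtr_ge0// sqr_enorm real_normK ?num_real//.
  have := Cauchy_Schwarz_dotp x (delta_mx 0 i).
  by rewrite !dotp_delta mxE !eqxx mulr1.
have [||P [polP [k Pk km] PK KP]] :=
  grid_polytope K (5 * n%:R) (15 * n ^ 3) n0 cK vK BK Kr.
- lra.
- by rewrite natrM natrX; lra.
exists P; split => //; exists k; split => //.
(* It remains to see that (30 n^3)^n <= n^(8 n), where 30 <= 2^5 <= n^5. *)
rewrite (_ : 8 * ln n%:R * n%:R = ln n%:R * (8 * n)%:R); last first.
  by rewrite natrM; ring.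
rewrite mulrC expRM_natl lnK ?posrE; last by lra.
rewrite -natrX ler_nat; apply: leq_trans km _.
rewrite expnM leq_exp2r// -mul2n mulnA (_ : 8 = 5 + 3)%N// expnD leq_mul2r.
have : (2 ^ 5 <= n ^ 5)%N by rewrite leq_exp2r.
by move=> n5; apply/orP; right; apply: leq_trans n5.
Qed.
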